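(* The following is provable in $\mathrm{PZFC}$ (in the logic BS4): if there is an inconsistent set and there is an incomplete set, i.e. if $\exists x\,(x^!\not\subseteq x^?)\wedge\exists x\,(x^?\not\subseteq x^!)$, then for any classical sets $u,v$ there is a set $x$ such that $x^!=u$ and $x^?=v$.
   Context: LOGIC BS4. BS4 is a four-valued first-order logic with primitive symbols $\sim$ (native negation), $\wedge,\vee,\to,\bot,\forall,\exists,=$; $\varphi\leftrightarrow\psi$ is $(\varphi\to\psi)\wedge(\psi\to\varphi)$. Vocabularies contain only constant and relation symbols. A T/F-model $\mathcal M$ has a (nonempty) domain $M$, an element $c^{\mathcal M}\in M$ for each constant, for each $n$-ary relation symbol $R$ two sets $(R^{\mathcal M})^+,(R^{\mathcal M})^-\subseteq M^n$ (with no relation assumed between them), the relation $=^+$ which is true identity on $M$, and a symmetric binary relation $=^-$ on $M$. Truth $\models^T$ and falsity $\models^F$ are defined recursively: an atomic formula is true iff its $+$ interpretation holds and false iff its $-$ interpretation holds; $\sim\varphi$ is true iff $\varphi$ is false, and false iff $\varphi$ is true; $\varphi\wedge\psi$ is true iff both are true, false iff at least one is false; $\varphi\vee\psi$ is true iff at least one is true, false iff both are false; $\varphi\to\psi$ is true iff ($\varphi$ true implies $\psi$ true), false iff $\varphi$ is true and $\psi$ is false; $\exists x\varphi$ is true iff some instance is true, false iff all instances are false; $\forall x\varphi$ is true iff all instances are true, false iff some instance is false; $\bot$ is never true and always false. $\Sigma\vdash_{BS4}\varphi$ means: for every T/F-model $\mathcal M$, if $\mathcal M\models^T\Sigma$ then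 $\mathcal M\models^T\varphi$ (there is a sound and complete Hilbert calculus for this relation). ''Provable in a theory $\Gamma$'' means $\Gamma\vdash_{BS4}$. ABBREVIATIONS. $\varphi\Rightarrow\psi$ is $(\varphi\to\psi)\wedge(\sim\psi\to\sim\varphi)$; $\varphi\Leftrightarrow\psi$ is $(\varphi\leftrightarrow\psi)\wedge(\sim\varphi\leftrightarrow\sim\psi)$; $\neg\varphi$ is $\varphi\to\bot$; $!\varphi$ is $\sim\neg\varphi$; $?\varphi$ is $\neg\sim\varphi$; $\circ\varphi$ is $!\varphi\leftrightarrow{?}\varphi$ (''$\varphi$ is classical''). $x\neq y$, $x\notin y$, $x\not\subseteq y$ are $\sim(x=y)$, $\sim(x\in y)$, $\sim(x\subseteq y)$. SETS. The language is $\{\in\}$. $x=\{y:\varphi(y)\}$ abbreviates $\forall y(y\in x\Leftrightarrow\varphi(y))$. $x\subseteq y$ is $\forall z(z\in x\Rightarrow z\in y)$. $x^!=\{y:{!}(y\in x)\}$, $x^?=\{y:{?}(y\in x)\}$. A set $x$ is complete if $\forall y(y\in x^?\to y\in x^!)$, consistent if $\forall y(y\in x^!\to y\in x^?)$, classical if $\forall y(y\in x^!\leftrightarrow y\in x^?)$; inconsistent/incomplete mean $x^!\not\subseteq x^?$ / $x^?\not\subseteq x^!$. $\{u_0,\dots,u_n\}=\{y:{!}(y=u_0)\vee\dots\vee{!}(y=u_n)\}$. $\langle u,v\rangle=\{\{u\},\{u,v\}\}$; the ordered pair $(a,b)$ is the set with $(a,b)^!=\{\langle x,\varnothing\rangle:x\in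 a^!\}\cup\{\langle y,\{\varnothing\}\rangle:y\in b^!\}$ and $(a,b)^?$ given likewise from $a^?,b^?$. $A\times B=\{(a,b):a\in A\wedge b\in B\}$; $\mathrm{dom}(R)=\{x:\exists y\,(x,y)\in R\}$. For a classical set $A$, a classical function from $A$ to $B$ is a classical set $f\subseteq A\times B$ with $\mathrm{dom}(f)=A$ and $\forall x\forall y\forall z(((x,y)\in f\wedge(x,z)\in f)\to{!}(y=z))$. AXIOMS OF PZFC (in BS4; schemas for all formulas $\varphi$, with parameters). Extensionality: $\forall x\forall y(x=y\Leftrightarrow\forall z(z\in x\Leftrightarrow z\in y))$. Comprehension: $\forall u\exists x\forall y(y\in x\Leftrightarrow(y\in u\wedge\varphi(y)))$. Classical Superset: $\forall x\exists C(x\subseteq C\wedge\forall y\,{\circ}(y\in C))$. Replacement: $[\forall x\forall y\,{\circ}\varphi(x,y)\wedge\forall x\exists y(\varphi(x,y)\wedge\forall z(\varphi(x,z)\to{!}(y=z)))]\to\forall x\exists y\forall z(z\in y\Leftrightarrow\exists w(w\in x\wedge\varphi(w,z)))$. Pairing: $\forall u\forall v\exists x\forall y(y\in x\Leftrightarrow({!}(y=u)\vee{!}(y=v)))$. Power Set: $\forall u\exists v\forall x(x\in v\Leftrightarrow{!}(x\subseteq u))$. Union: $\forall u\exists x\forall y(y\in x\Leftrightarrow\exists z(y\in z\wedge z\in u))$. Infinity: $\exists x(\varnothing\in x\wedge\forall y(y\in x\to y\cup\{y\}\in x))$. Foundation: $\forall x(\forall y(y\in x^!\cup x^?\to\varphi(y))\to\varphi(x))\to\forall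 u\,\varphi(u)$. Choice: for every classical $u$, if $\forall x(x\in u\to\exists y(y\in x))$ then there is a classical function $f$ with $\mathrm{dom}(f)=u$ and $f(x)\in x$ for all $x\in u$. *)

(* Defs.v *)
From mathcomp Require Import all_boot.

Set Implicit Arguments.
Unset Strict Implicit.
Unset Printing Implicit Defensive.

(** * Syntax of BS4 over the vocabulary {∈} *)

(* The vocabulary has no constants, so the only terms are variables. *)
Definition var := nat.

Inductive form : Type :=
| Mem (x y : var)
| Eq (x y : var)
| Bot
| Neg (p : form)
| And (p q : form)
| Or (p q : form)
| Imp (p q : form)
| All (x : var) (p : form)
| Ex (x : var) (p : form).

Declare Scope bs4_scope.
Delimit Scope bs4_scope with bs4.
Bind Scope bs4_scope with form.
Local Open Scope bs4_scope.

Notation "x ∈ y" := (Mem x y) (at level 60, no associativity) : bs4_scope.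
Notation "x ≐ y" := (Eq x y) (at level 60, no associativity) : bs4_scope.
Notation "∼ p" := (Neg p) (at level 65, right associativity) : bs4_scope.
Notation "p ∧ q" := (And p q) (at level 70, right associativity) : bs4_scope.
Notation "p ∨ q" := (Or p q) (at level 75, right associativity) : bs4_scope.
Notation "p ⟶ q" := (Imp p q) (at level 80, right associativity) : bs4_scope.
Notation "∀ x , p" := (All x p) (at level 90, x at level 50, p at level 90)
  : bs4_scope.
Notation "∃ x , p" := (Ex x p) (at level 90, x at level 50, p at level 90)
  : bs4_scope.

Fixpoint vars (p : form) : seq var :=
  match p with
  | Mem x y | Eq x y => [:: x; y]
  | Bot => [::]
  | Neg p => vars p
  | And p q | Or p q | Imp p q => vars p ++ vars q
  | All x p | Ex x p => x :: vars p
  end.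

Fixpoint fv (p : form) : seq var :=
  match p with
  | Mem x y | Eq x y => [:: x; y]
  | Bot => [::]
  | Neg p => fv p
  | And p q | Or p q | Imp p q => fv p ++ fv q
  | All x p | Ex x p => [seq y <- fv p | y != x]
  end.

Definition subst_var (z x y : var) : var := if y == x then z else y.

(* Replaces the free occurrences of x by z.  Bound variables are not renamed,
   so this is the usual substitution only when z is not captured; it is used
   below only for z that do not occur in p at all. *)
Fixpoint subst (z x : var) (p : form) : form :=
  match p with
  | Mem a b => Mem (subst_var z x a) (subst_var z x b)
  | Eq a b => Eq (subst_var z x a) (subst_var z x b)
  | Bot => Bot
  | Neg p => Neg (subst z x p)
  | And p q => And (subst z x p) (subst z x q)
  | Or p q => Or (subst z x p) (subst z x q)
  | Imp p q => Imp (subst z x p) (subst z x q)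
  | All y p => if y == x then All y p else All y (subst z x p)
  | Ex y p => if y == x then Ex y p else Ex y (subst z x p)
  end.

Notation "p ⟦ z // x ⟧" := (subst z x p)
  (at level 2, z at level 50, x at level 50, left associativity,
   format "p ⟦ z // x ⟧") : bs4_scope.

(** * Semantics *)

Record TFmodel := {
  dom :> Type;
  dom_inhabited : inhabited dom;
  memT : dom -> dom -> Prop;
  memF : dom -> dom -> Prop;
  eqF : dom -> dom -> Prop;
  eqF_sym : forall a b, eqF a b -> eqF b a }.

Definition update (M : Type) (e : var -> M) (x : var) (a : M) : var -> M :=
  fun y => if y == x then a else e y.

Fixpoint satT (M : TFmodel) (e : var -> M) (p : form) {struct p} : Prop :=
  match p with
  | Mem x y => memT (e x) (e y)
  | Eq x y => e x = e y
  | Bot => False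
  | Neg p => satF e p
  | And p q => satT e p /\ satT e q
  | Or p q => satT e p \/ satT e q
  | Imp p q => satT e p -> satT e q
  | All x p => forall a : M, satT (update e x a) p
  | Ex x p => exists a : M, satT (update e x a) p
  end
with satF (M : TFmodel) (e : var -> M) (p : form) {struct p} : Prop :=
  match p with
  | Mem x y => memF (e x) (e y)
  | Eq x y => eqF (e x) (e y)
  | Bot => True
  | Neg p => satT e p
  | And p q => satF e p \/ satF e q
  | Or p q => satF e p /\ satF e q
  | Imp p q => satT e p /\ satF e q
  | All x p => exists a : M, satF (update e x a) p
  | Ex x p => forall a : M, satF (update e x a) p
  end.

(* Truth under every assignment: a formula with free variables (parameters)
   stands for its universal closure. *)
Definition holds (M : TFmodel) (p : form) : Prop :=
  forall e : var -> M, satT e p.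

Definition entails (S : form -> Prop) (p : form) : Prop :=
  forall M : TFmodel, (forall q, S q -> holds M q) -> holds M p.

Notation "S ⊢ p" := (entails S p%bs4) (at level 95, p at level 94).

(** * Abbreviations *)

Notation "p ⟷ q" := (And (Imp p q) (Imp q p))
  (at level 80, no associativity) : bs4_scope.
Notation "p ⟹ q" := (And (Imp p q) (Imp (Neg q) (Neg p)))
  (at level 80, right associativity) : bs4_scope.
Notation "p ⟺ q" := (And (p ⟷ q) (Neg p ⟷ Neg q))
  (at level 80, no associativity) : bs4_scope.

Definition Not (p : form) : form := p ⟶ Bot.
Definition Bang (p : form) : form := ∼ Not p.
Definition Quest (p : form) : form := Not (∼ p).
Definition Circ (p : form) : form := Bang p ⟷ Quest p.

Notation "y ∈! x" := (Bang (Mem y x)) (at level 60, no associativity)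
  : bs4_scope.
Notation "y ∈? x" := (Quest (Mem y x)) (at level 60, no associativity)
  : bs4_scope.

(* A variable outside s, used to bind the quantifiers hidden in abbreviations. *)
Definition fresh (s : seq var) : var := (foldr maxn 0 s).+1.

(* A class term {y : p(y)} is never a term of the language:
   - y ∈ {y : p} is p, so y ∈ x^! is y ∈! x and y ∈ x^? is y ∈? x;
   - x = {y : p} is ∀y (y ∈ x ⟺ p);
   - {y : p} ⊆ {y : q} is ∀y (p ⟹ q);
   - elsewhere C({y : p}) is ∃w (Bang (w = {y : p}) ∧ C(w)), where Bang keeps
     the falsity value of C({y : p}) independent of that of w = {y : p}. *)

Definition subset (x y : var) : form :=
  let z := fresh [:: x; y] in ∀ z, (z ∈ x ⟹ z ∈ y).

Definition classical (x : var) : form :=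
  let y := fresh [:: x] in ∀ y, (y ∈! x ⟷ y ∈? x).

(* x^! ⊈ x^? *)
Definition inconsistent (x : var) : form :=
  let y := fresh [:: x] in ∼ (∀ y, (y ∈! x ⟹ y ∈? x)).

(* x^? ⊈ x^! *)
Definition incomplete (x : var) : form :=
  let y := fresh [:: x] in ∼ (∀ y, (y ∈? x ⟹ y ∈! x)).

(* u = x^! *)
Definition is_bang_part (u x : var) : form :=
  let y := fresh [:: u; x] in ∀ y, (y ∈ u ⟺ y ∈! x).

(* u = x^? *)
Definition is_quest_part (u x : var) : form :=
  let y := fresh [:: u; x] in ∀ y, (y ∈ u ⟺ y ∈? x).

(* w = {y : ⊥} *)
Definition is_empty (w : var) : form :=
  let y := fresh [:: w] in ∀ y, (y ∈ w ⟺ Bot).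

(* w = {u} *)
Definition is_single (w u : var) : form :=
  let y := fresh [:: w; u] in ∀ y, (y ∈ w ⟺ Bang (y ≐ u)).

(* w = {u, v} *)
Definition is_upair (w u v : var) : form :=
  let y := fresh [:: w; u; v] in
  ∀ y, (y ∈ w ⟺ (Bang (y ≐ u) ∨ Bang (y ≐ v))).

(* w = y ∪ {y} *)
Definition is_succ (w y : var) : form :=
  let z := fresh [:: w; y] in ∀ z, (z ∈ w ⟺ (z ∈ y ∨ Bang (z ≐ y))).

(* w = ⟨u, v⟩ = {{u}, {u, v}} *)
Definition is_kpair (w u v : var) : form :=
  let y := fresh [:: w; u; v] in
  ∀ y, (y ∈ w ⟺ (Bang (is_single y u) ∨ Bang (is_upair y u v))).

(* w = ⟨x, ∅⟩ *)
Definition is_left_tag (w x : var) : form :=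
  let e := fresh [:: w; x] in ∃ e, (Bang (is_empty e) ∧ is_kpair w x e).

(* w = ⟨x, {∅}⟩ *)
Definition is_right_tag (w x : var) : form :=
  let e := fresh [:: w; x] in
  let s := fresh [:: w; x; e] in
  ∃ e, ∃ s, (Bang (is_empty e) ∧ Bang (is_single s e) ∧ is_kpair w x s).

(* w = (a, b), the ordered pair that may be inconsistent or incomplete *)
Definition is_opair (w a b : var) : form :=
  let z := fresh [:: w; a; b] in
  let x := fresh [:: w; a; b; z] in
  (∀ z, (z ∈! w ⟺ ((∃ x, (x ∈! a ∧ Bang (is_left_tag z x)))
                    ∨ (∃ x, (x ∈! b ∧ Bang (is_right_tag z x))))))
  ∧ (∀ z, (z ∈? w ⟺ ((∃ x, (x ∈? a ∧ Bang (is_left_tag z x)))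
                      ∨ (∃ x, (x ∈? b ∧ Bang (is_right_tag z x)))))).

(* (x, y) ∈ R *)
Definition opair_in (x y R : var) : form :=
  let p := fresh [:: x; y; R] in ∃ p, (Bang (is_opair p x y) ∧ p ∈ R).

(* z ∈ A × B *)
Definition in_prod (z A B : var) : form :=
  let a := fresh [:: z; A; B] in
  let b := fresh [:: z; A; B; a] in
  ∃ a, ∃ b, ((a ∈ A ∧ b ∈ B) ∧ Bang (is_opair z a b)).

(* A = dom(R) *)
Definition is_dom (A R : var) : form :=
  let x := fresh [:: A; R] in
  let y := fresh [:: A; R; x] in
  ∀ x, (x ∈ A ⟺ ∃ y, opair_in x y R).

(* f is a classical function from A to B (A is assumed classical) *)
Definition classical_function (f A B : var) : form :=
  let x := fresh [:: f; A; B] in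
  let y := fresh [:: f; A; B; x] in
  let z := fresh [:: f; A; B; x; y] in
  classical f
  ∧ (∀ z, (z ∈ f ⟹ in_prod z A B))
  ∧ is_dom A f
  ∧ (∀ x, ∀ y, ∀ z, ((opair_in x y f ∧ opair_in x z f) ⟶ Bang (y ≐ z))).

(** * The axioms of PZFC *)

(* The bound variables are arbitrary pairwise distinct variables.  In the
   schemas, p may contain further free variables as parameters. *)
Inductive PZFC : form -> Prop :=
| Extensionality (x y z : var) :
    uniq [:: x; y; z] ->
    PZFC (∀ x, ∀ y, (x ≐ y ⟺ ∀ z, (z ∈ x ⟺ z ∈ y)))
| Comprehension (u x y : var) (p : form) :
    uniq [:: u; x; y] -> x \notin fv p ->
    PZFC (∀ u, ∃ x, ∀ y, (y ∈ x ⟺ (y ∈ u ∧ p)))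
| ClassicalSuperset (x C y : var) :
    uniq [:: x; C; y] ->
    PZFC (∀ x, ∃ C, (subset x C ∧ ∀ y, Circ (y ∈ C)))
| Replacement (x y z w : var) (p : form) :
    uniq [:: x; y; z; w] -> z \notin vars p -> w \notin vars p ->
    PZFC (((∀ x, ∀ y, Circ p)
           ∧ (∀ x, ∃ y, (p ∧ ∀ z, (p⟦z // y⟧ ⟶ Bang (y ≐ z)))))
          ⟶ ∀ x, ∃ y, ∀ z, (z ∈ y ⟺ ∃ w, (w ∈ x ∧ p⟦w // x⟧⟦z // y⟧)))
| Pairing (u v x y : var) :
    uniq [:: u; v; x; y] ->
    PZFC (∀ u, ∀ v, ∃ x, ∀ y, (y ∈ x ⟺ (Bang (y ≐ u) ∨ Bang (y ≐ v))))
| PowerSet (u v x : var) :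
    uniq [:: u; v; x] ->
    PZFC (∀ u, ∃ v, ∀ x, (x ∈ v ⟺ Bang (subset x u)))
| Union (u x y z : var) :
    uniq [:: u; x; y; z] ->
    PZFC (∀ u, ∃ x, ∀ y, (y ∈ x ⟺ ∃ z, (y ∈ z ∧ z ∈ u)))
| Infinity (x y e s : var) :
    uniq [:: x; y; e; s] ->
    PZFC (∃ x, ((∃ e, (Bang (is_empty e) ∧ e ∈ x))
                ∧ (∀ y, (y ∈ x ⟶ ∃ s, (Bang (is_succ s y) ∧ s ∈ x)))))
| Foundation (x y u : var) (p : form) :
    uniq [:: x; y; u] -> y \notin vars p -> u \notin vars p ->
    PZFC ((∀ x, ((∀ y, ((y ∈! x ∨ y ∈? x) ⟶ p⟦y // x⟧)) ⟶ p))
          ⟶ ∀ u, p⟦u // x⟧)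
| Choice (u x y f B : var) :
    uniq [:: u; x; y; f; B] ->
    PZFC (∀ u, (classical u
                ⟶ (∀ x, (x ∈ u ⟶ ∃ y, y ∈ x))
                ⟶ ∃ f, ((∃ B, classical_function f u B)
                         ∧ (∀ x, (x ∈ u ⟶ ∃ y, (Bang (opair_in x y f)
                                                 ∧ y ∈ x)))))).

(* Main.v *)
Require Import Defs.
From mathcomp Require Import all_boot.
From Stdlib Require Import Classical.

(** Let b be a membership statement that is both true and false, and n one that
    is neither.  On classical u, v the formula (y ∈ u ∧ b) ∨ (y ∈ v ∧ n) is true
    exactly when y ∈ u is true, and false exactly when y ∈ v is false; separating
    by it from u ∪ v yields the required set. *)

Lemma fresh_gt (s : seq var) (x : var) : x \in s -> x < fresh s.
Proof.
rewrite /fresh ltnS; elim: s => //= y s IHs.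
rewrite inE leq_max => /predU1P [->|/IHs ->]; first by rewrite leqnn.
by rewrite orbT.
Qed.

Lemma update_same (M : Type) (e : var -> M) (x : var) (a : M) :
  update e x a x = a.
Proof. by rewrite /update eqxx. Qed.

Lemma update_neq (M : Type) (e : var -> M) (x y : var) (a : M) :
  y != x -> update e x a y = e y.
Proof. by rewrite /update => /negbTE ->. Qed.

Lemma update_fresh (M : Type) (e : var -> M) (s : seq var) (a : M) (x : var) :
  x \in s -> update e (fresh s) a x = e x.
Proof. by move=> /fresh_gt lt_x; rewrite update_neq // neq_ltn lt_x. Qed.

(** [y ∈! x] is true iff [y ∈ x] is true, and [y ∈? x] is false iff [y ∈ x] is false, so either half
    of [⟹] is false only where [y ∈ x] is both true and false. *)
Lemma inconsistentP (M : TFmodel) (e : var -> M) (x : var) :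
  satT e (inconsistent x) -> exists y : M, memT y (e x) /\ memF y (e x).
Proof.
case=> y; rewrite /= update_same update_fresh ?mem_head // => Hy.
by exists y; tauto.
Qed.

Lemma incompleteP (M : TFmodel) (e : var -> M) (x : var) :
  satT e (incomplete x) -> exists y : M, ~ memT y (e x) /\ ~ memF y (e x).
Proof.
case=> y; rewrite /= update_same update_fresh ?mem_head // => Hy.
by exists y; tauto.
Qed.

Lemma classicalP (M : TFmodel) (e : var -> M) (x : var) :
  satT e (classical x) -> forall y : M, memF y (e x) <-> ~ memT y (e x).
Proof.
move=> cl_x y; have := cl_x y.
rewrite /= update_same update_fresh ?mem_head // => Hy.
by have := classic (memF y (e x)); tauto.
Qed.

(** A [Bang] formula is two-valued, false exactly when its argument is not true; hence falsity of
    membership in [x] does not matter here. For [Quest] it is truth that does not matter. *)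
Lemma satT_bang_part (M : TFmodel) (e : var -> M) (u x : var) :
  (forall y : M, (memT y (e u) <-> memT y (e x))
                 /\ (memF y (e u) <-> ~ memT y (e x))) ->
  satT e (is_bang_part u x).
Proof.
move=> Hux; rewrite /is_bang_part /= => y; have := Hux y.
by rewrite update_same !update_fresh ?inE ?eqxx ?orbT //; tauto.
Qed.

Lemma satT_quest_part (M : TFmodel) (e : var -> M) (u x : var) :
  (forall y : M, (memT y (e u) <-> ~ memF y (e x))
                 /\ (memF y (e u) <-> memF y (e x))) ->
  satT e (is_quest_part u x).
Proof.
move=> Hux; rewrite /is_quest_part /= => y; have := Hux y.
by rewrite update_same !update_fresh ?inE ?eqxx ?orbT //; tauto.
Qed.

Lemma binary_union (M : TFmodel) (PZFC_M : forall q, PZFC q -> holds M q)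
    (a b : M) :
  exists c : M, forall y : M, (memT y c <-> memT y a \/ memT y b)
                              /\ (memF y c <-> memF y a /\ memF y b).
Proof.
have [w /= Hw] := PZFC_M _ (@Pairing 0 1 2 3 isT) (fun=> a) a b.
have [c /= Hc] := PZFC_M _ (@Union 0 1 2 3 isT) (fun=> a) w.
rewrite /update /= in Hw Hc.
exists c => y; have [[cT1 cT2] [cF1 cF2]] := Hc y.
split; split.
- by move=> /cT1 [z [yz /(proj1 (proj1 (Hw z)))]]; case=> [[zE _]|[zE _]];
    rewrite -zE; [left | right].
- by move=> [ya|yb]; apply: cT2; [exists a | exists b]; split=> //;
    apply: (proj2 (proj1 (Hw _))); [left | right].
(* The pair [w] is two-valued, thanks to [Bang] in Pairing: [a ∈ w] and [b ∈ w] are not false, so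
   falsity must come from [y ∈ a] and [y ∈ b]. *)
- move=> /cF1 Hy; split.
  + by case: (Hy a) => // /(proj1 (proj2 (Hw a))) [na _]; case: na.
  + by case: (Hy b) => // /(proj1 (proj2 (Hw b))) [_ nb]; case: nb.
- move=> [ya yb]; apply: cF2 => z.
  have [->|za] := classic (z = a); first by left.
  have [->|zb] := classic (z = b); first by left.
  by right; exact: (proj2 (proj2 (Hw z)) (conj za zb)).
Qed.

Lemma separation_by_two_sentences (M : TFmodel)
    (PZFC_M : forall q, PZFC q -> holds M q) (c u v i j k l : M) :
  exists x : M, forall y : M,
    (memT y x <-> memT y c
                  /\ (memT y u /\ memT i j \/ memT y v /\ memT k l))
    /\ (memF y x <-> memF y c
                     \/ ((memF y u \/ memF i j) /\ (memF y v \/ memF k l))).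
Proof.
pose p : form := ((2 ∈ 3 ∧ 5 ∈ 6) ∨ (2 ∈ 4 ∧ 7 ∈ 8))%bs4.
(* Variables 0, 1, 2 are bound by Comprehension, so their value [c] is a dummy; variables 3 to 8
   carry the parameters of [p]. *)
pose e := nth c [:: c; c; c; u; v; i; j; k; l].
have [x Hx] := PZFC_M _ (@Comprehension 0 1 2 p isT isT) e c.
by exists x => y; have := Hx y; rewrite /= /update /=; tauto.
Qed.

Theorem theorem5p2 (u v x : var) (huvx : uniq [:: u; v; x]) :
  PZFC ⊢ ((∃ x, inconsistent x) ∧ (∃ x, incomplete x)
          ⟶ ∀ u, ∀ v, ((classical u ∧ classical v)
                        ⟶ ∃ x, (is_bang_part u x ∧ is_quest_part v x))).
Proof.
(* [i ∈ j] will be the statement that is both true and false, [k ∈ l] the one that is neither. *)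
move=> M PZFC_M e [[j /inconsistentP [i [ijT ijF]]]].
move=> [l /incompleteP [k [klT klF]]] a b [/classicalP cl_u /classicalP cl_v].
move: huvx; rewrite /= !inE negb_or => /and3P [/andP [neq_uv neq_ux] neq_vx _].
rewrite !update_same update_neq // update_same in ijT ijF klT klF cl_u cl_v.
have [c Hc] := binary_union M PZFC_M a b.
have [d Hd] := separation_by_two_sentences M PZFC_M c a b i j k l.
exists d; split; [apply: satT_bang_part | apply: satT_quest_part] => y.
(* Truth in [d]: the disjunct with [k ∈ l] is never true, which leaves truth in [a]. *)
- rewrite update_same 2?update_neq // update_same.
  by have := (Hc y, Hd y, cl_u y); tauto.
(* Falsity in [d]: the disjunct with [i ∈ j] is always false, which leaves falsity in [b]. Excluded
   middle recovers truth in [b] from absence of falsity. *)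
- rewrite update_same update_neq // update_same.
  by have := (Hc y, Hd y, cl_v y, classic (memT y b)); tauto.
Qed.
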